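(* Every psd-stable binomial $f\in\mathbb{C}[Z]$ on the space of complex symmetric $n\times n$ matrices is of one of the following forms, where $c_1,c_2\in\mathbb{C}\setminus\{0\}$ and $Z^\gamma$ is a diagonal monomial: a) Only diagonal variables appear in $f$, and $f(Z)=Z^\gamma(c_1Z^{\alpha_1}+c_2Z^{\alpha_2})$, where $Z^{\alpha_1},Z^{\alpha_2}$ have no common factor, $|\alpha_1-\alpha_2|\le 2$, at least one of $\alpha_1,\alpha_2$ is non-zero, and one of the following holds: (i) $\{Z^{\alpha_1},Z^{\alpha_2}\}=\{1,z_{ii}\}$ for some $i\in[n]$; (ii) $\{Z^{\alpha_1},Z^{\alpha_2}\}=\{z_{ii},z_{jj}\}$ for some $i,j\in[n]$ and $\frac{c_1}{c_2}\in\mathbb{R}_{\ge 0}$; (iii) $\{Z^{\alpha_1},Z^{\alpha_2}\}=\{1,z_{ii}z_{jj}\}$ for some $i,j\in[n]$ (possibly equal) and $\frac{c_1}{c_2}\in\mathbb{R}_{<0}$. b) $f(Z)=Z^\gamma(c_1z_{ii}z_{jj}+c_2z_{ij}^2)$ for some $i<j$, with $\frac{c_1}{c_2}\in\mathbb{R}$.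
   Context: $[n]=\{1,\dots,n\}$. $\mathbb{C}[Z]$ denotes the ring of polynomials in the entries $z_{ij}$ of a symmetric $n\times n$ variable matrix $Z=(z_{ij})$, with $z_{ij}$ and $z_{ji}$ identified. Monomials are written $Z^\alpha=\prod_{1\le i,j\le n} z_{ij}^{\alpha_{ij}}$, where $\alpha$ is a symmetric matrix with non-negative entries, whose diagonal entries are integers and whose off-diagonal entries are half-integers (so for $i<j$ the variable $z_{ij}$ has exponent $2\alpha_{ij}$). For a symmetric matrix $\alpha$, $|\alpha|=\sum_{i,j}|\alpha_{ij}|$. The variables $z_{ii}$ are the diagonal variables; a monomial $Z^\gamma$ is diagonal if $\gamma_{ij}=0$ for all $i\neq j$ (constants are diagonal monomials). A binomial is a polynomial with exactly two distinct monomials having non-zero coefficients. A polynomial $f\in\mathbb{C}[Z]$ is psd-stable if $f(M)\ne 0$ for every complex symmetric $n\times n$ matrix $M$ whose entrywise imaginary part $\mathrm{Im}(M)$ is positive definite. *)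

(* Defs.v *)
From HB Require Import structures.
From mathcomp Require Import all_boot all_order all_algebra.
From mathcomp Require Import reals complex mpoly.

Set Implicit Arguments.
Unset Strict Implicit.
Unset Printing Implicit Defensive.

Import Order.TTheory GRing.Theory Num.Theory.
Local Open Scope ring_scope.

(* z_ij and z_ji are identified, so there is one variable per pair (i, j) with
   i <= j; mpoly indexes it by its rank in the enumeration of these pairs. *)
Definition upair (n : nat) : finType :=
  {p : 'I_n * 'I_n | (p.1 <= p.2)%N}.

Definition nvar (n : nat) : nat := #|upair n|.

Notation polyZ R n := {mpoly (R[i]) [nvar n]}.

Definition sort_pair (n : nat) (i j : 'I_n) : 'I_n * 'I_n :=
  if (i <= j)%N then (i, j) else (j, i).

Lemma sort_pair_le (n : nat) (i j : 'I_n) :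
  ((sort_pair i j).1 <= (sort_pair i j).2)%N.
Proof. by rewrite /sort_pair; case: (leqP i j) => [//|/ltnW]. Qed.

Definition zidx (n : nat) (i j : 'I_n) : 'I_(nvar n) :=
  enum_rank (exist _ (sort_pair i j) (sort_pair_le i j) : upair n).

Definition zvar (R : realType) (n : nat) (i j : 'I_n) : polyZ R n :=
  'X_(zidx i j).

Definition zeval (R : realType) (n : nat) (M : 'M[R[i]]_n) (f : polyZ R n)
    : R[i] :=
  f.@[fun k => M (val (enum_val k)).1 (val (enum_val k)).2].

Lemma zidxC (n : nat) (i j : 'I_n) : zidx i j = zidx j i.
Proof.
congr enum_rank; apply: val_inj; rewrite /= /sort_pair.
by case: ltngtP => // /val_inj ->.
Qed.

Lemma zeval_zvar (R : realType) (n : nat) (M : 'M[R[i]]_n) (i j : 'I_n) :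
  M^T = M -> zeval M (zvar R i j) = M i j.
Proof.
move=> symM; rewrite /zeval mevalXU enum_rankK /= /sort_pair.
by case: leqP => //= _; rewrite -[in LHS]symM mxE.
Qed.

Definition posdef (R : realType) (n : nat) (A : 'M[R]_n) : Prop :=
  A^T = A /\ forall x : 'cV[R]_n, x != 0 -> 0 < (x^T *m A *m x) 0 0.

Definition psd_stable (R : realType) (n : nat) (f : polyZ R n) : Prop :=
  forall M : 'M[R[i]]_n,
    M^T = M -> posdef (map_mx (@complex.Im R) M) -> zeval M f != 0.

Definition binomial_poly (R : realType) (n : nat) (f : polyZ R n) : Prop :=
  size (msupp f) = 2%N.

Definition is_exponent (n : nat) (a : 'M[rat]_n) : Prop :=
  [/\ a^T = a,
      forall i j, 0 <= a i j,
      forall i, a i i \is a Num.int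
    & forall i j, i != j -> 2 * a i j \is a Num.int].

(* Z^a is the product of the z_ij ^ a_ij over all ordered pairs (i, j); for
   i < j the two factors z_ij ^ a_ij and z_ji ^ a_ji combine into
   z_ij ^ (2 a_ij).  Num.truncn is exact here when a is an exponent. *)
Definition Zmon (R : realType) (n : nat) (a : 'M[rat]_n) : polyZ R n :=
  (\prod_(i < n) zvar R i i ^+ Num.truncn (a i i)) *
  \prod_(i < n) \prod_(j < n | (i < j)%N)
     zvar R i j ^+ Num.truncn (2 * a i j).

Definition norm1 (n : nat) (a : 'M[rat]_n) : rat :=
  \sum_(i < n) \sum_(j < n) `|a i j|.

Definition only_diag_vars (R : realType) (n : nat) (f : polyZ R n) : Prop :=
  forall m, m \in msupp f -> forall i j : 'I_n, i != j -> m (zidx i j) = 0%N.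

Definition no_common_factor (R : realType) (n : nat) (p q : polyZ R n) : Prop :=
  forall g h k : polyZ R n,
    p = g * h -> q = g * k -> g \is a GRing.unit.

(* Main.v *)
Require Import Defs.
From mathcomp Require Import all_boot all_order all_algebra.
From mathcomp Require Import reals complex mpoly.
From mathcomp Require Import separable cyclotomic ring zify.

Set Implicit Arguments.
Unset Strict Implicit.
Unset Printing Implicit Defensive.

Import Order.TTheory GRing.Theory Num.Theory.
Local Open Scope ring_scope.

(* Evaluating at iI shows that one of the two terms has no off-diagonal
   variable.  After dividing by the common diagonal monomial, write
   f = c1 Z^a + c2 Z^b Q, where a, b are diagonal with disjoint supports and
   degrees A, B, and Q is an off-diagonal monomial of degree E.
   - Putting ones off the diagonal, w at the diagonal places outside the support
     of a, and -1/w on it, turns f = 0 into w^(A+B) = -(c1/c2) (-1)^A.  If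
     A + B > 2 this has a solution in the upper half plane, because there are
     non-real (A+B)-th roots of unity; if A + B = 2 it has one unless the right
     hand side is a nonnegative real.
   - If z_ij occurs in Q, take L times a matrix with i on the diagonal and ones
     off it, except for a complex number t of modulus < 1 at (i, j).  Then f = 0
     determines a power of t in terms of L^(A-B-E), which is small for L small
     or L large unless A = B + E.
   - Otherwise A = B + E, hence B = 0 by the first point.  If i were not in the
     support of a, then z_ii could be taken so large that z_ij may be chosen
     freely, and f would vanish somewhere.  So i and j both belong to the
     support of a, which with A <= 2 forces Z^a = z_ii z_jj and Q = z_ij^2. *)

(** * Roots in the upper half plane *)

(** In characteristic 0 the polynomial X^m - 1 is separable, so it has m distinct roots. A real one
    has modulus 1, hence is 1 or -1, and m > 2 leaves room for another. *)
Lemma nonreal_unity_root (C : numClosedFieldType) (m : nat) :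
  (2 < m)%N -> exists2 z : C, z ^+ m = 1 & z \isn't Num.real.
Proof.
move=> m2; have m0 : (0 < m)%N by exact: leq_trans m2.
have [r defp] := closed_field_poly_normal ('X^m - 1 : {poly C}).
rewrite (monicP (monicXnsubC 1 m0)) scale1r in defp.
have szr : size r = m.
  by apply/eqP; rewrite -eqSS -(size_prod_XsubC _ id) -defp size_XnsubC.
have uniqr : uniq r.
  by rewrite -separable_prod_XsubC -defp separable_Xn_sub_1 // pnatr_eq0 -lt0n.
have rootr z : z \in r -> z ^+ m = 1.
  rewrite -root_prod_XsubC -defp rootE !hornerE subr_eq0.
  by move/eqP.
have [/allP realr|/allPn[z /rootr zm nz]] := boolP (all (mem Num.real) r);
  last by exists z.
have: (size r <= size [:: (1 : C); (-1 : C)]%R)%N.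
  apply: uniq_leq_size => // z zr; have zm := rootr z zr.
  have : `|z| == 1.
    by rewrite -(@pexpr_eq1 _ _ m) // -normrX zm normr1.
  by rewrite real_eqr_norml ?ler01 ?andbT ?inE //; exact: realr.
by rewrite szr leqNgt m2.
Qed.

(** The principal root has nonnegative imaginary part. If it is real, multiplying it by a non-real
    root of unity or by the conjugate of that root moves it into the upper half plane. *)
Lemma upper_root (C : numClosedFieldType) (m : nat) (s : C) :
  (2 < m)%N -> s != 0 -> exists2 w : C, 0 < 'Im w & w ^+ m = s.
Proof.
move=> m2 s0; have m0 : (0 < m)%N by exact: leq_trans m2.
have wm : m.-root s ^+ m = s by rewrite rootCK.
set w := m.-root s in wm.
have := @Im_rootC_ge0 C m s (ltnW m2); rewrite -/w le_eqVlt.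
case/predU1P => [/esym/Creal_ImP w_real|]; last by exists w.
have w0 : w != 0 by rewrite rootC_eq0.
have [z zm z_nreal] := @nonreal_unity_root C m m2.
have : 'Im (w * z) != 0.
  by rewrite ImMl// mulf_neq0// (sameP eqP (Creal_ImP z)).
rewrite (real_neqr_lt (Creal_Im _) (@real0 C)) => /orP[Imw|Imw].
  exists (w * z^*); first by rewrite ImMl // Im_conj mulrN -ImMl// oppr_gt0.
  by rewrite exprMn wm -rmorphXn zm rmorph1 mulr1.
by exists (w * z); rewrite // exprMn wm zm mulr1.
Qed.

(** If the principal square root were not strictly above the real axis it would be real, and its
    square [s] would be nonnegative. *)
Lemma upper_sqrt (C : numClosedFieldType) (s : C) :
  ~~ (0 <= s) -> exists2 w : C, 0 < 'Im w & w ^+ 2 = s.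
Proof.
move=> s_nge0; exists (sqrtC s); last exact: sqrtCK.
rewrite lt_neqAle Im_rootC_ge0// andbT eq_sym.
apply: contra s_nge0; rewrite (sameP eqP (Creal_ImP _)) => ?.
by rewrite -[s]sqrtCK -realEsqr.
Qed.

(** * Test matrices with positive definite imaginary part *)

(* For i = j the value t is not used. *)
Definition probe_mx {K : Type} {n : nat} (d : 'I_n -> K) (i j : 'I_n) (t s : K)
    : 'M[K]_n :=
  \matrix_(k, l) if k == l then d k
    else if ((k, l) == (i, j)) || ((k, l) == (j, i)) then t else s.

Lemma probe_mxT (K : Type) (n : nat) (d : 'I_n -> K) (i j : 'I_n) (t s : K) :
  (probe_mx d i j t s)^T = probe_mx d i j t s.
Proof.
apply/matrixP => k l; rewrite !mxE eq_sym; case: eqVneq => [->//|_].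
by rewrite !xpair_eqE orbC (andbC (k == j)) (andbC (k == i)).
Qed.

Lemma quad_probe_mx (R : realType) (n : nat) (y : 'I_n -> R) (i j : 'I_n)
    (t : R) (x : 'cV[R]_n) :
  (x^T *m probe_mx y i j t 0 *m x) 0 0 =
  \sum_k y k * x k 0 ^+ 2 + (t * x i 0 * x j 0) *+ 2 *+ (i != j).
Proof.
have -> : (x^T *m probe_mx y i j t 0 *m x) 0 0 =
    \sum_l \sum_k x k 0 * probe_mx y i j t 0 k l * x l 0.
  rewrite !mxE; apply: eq_bigr => l _; rewrite !mxE mulr_suml.
  by apply: eq_bigr => k _; rewrite mxE.
(* The two indicators mark the positions (i, j) and (j, i). They coincide only for i = j, where
   [t *+ (i != j)] is 0. *)
have -> : \sum_l \sum_k x k 0 * probe_mx y i j t 0 k l * x l 0 =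
    \sum_l (y l * x l 0 ^+ 2 +
      \sum_k (((k == i) && (l == j))%:R + ((k == j) && (l == i))%:R) *
         (t *+ (i != j) * x k 0 * x l 0)).
  apply: eq_bigr => l _; rewrite (bigD1 l)//= [in RHS](bigD1 l)//= addrA.
  congr (_ + _); last first.
    apply: eq_bigr => k kl; rewrite mxE (negbTE kl) !xpair_eqE.
    case: (boolP ((k == i) && (l == j))) => [/andP[/eqP <- /eqP <-]|_] /=.
      by rewrite kl (negbTE kl) addr0 mulr1n /=; ring.
    case: (boolP ((k == j) && (l == i))) => [/andP[/eqP <- /eqP <-]|_] /=.
      by rewrite eq_sym kl mulr1n /=; ring.
    by rewrite mulr0 mul0r add0r mul0r.
  rewrite mxE eqxx; have [->|li] := eqVneq l i; have [ij|ij] := eqVneq i j => /=;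
     rewrite ?eqxx ?andbF ?(negbTE ij) ?mulr0n /=; ring.
rewrite big_split /=; congr (_ + _).
transitivity (\sum_l \sum_k ((k == i) && (l == j))%:R * (t *+ (i != j) * x k 0 * x l 0)
  + \sum_l \sum_k ((k == j) && (l == i))%:R * (t *+ (i != j) * x k 0 * x l 0)).
  rewrite -big_split; apply: eq_bigr => l _; rewrite -big_split.
  by apply: eq_bigr => k _; rewrite /= mulrDl.
have pick (a b : 'I_n) : \sum_l \sum_k ((k == a) && (l == b))%:R *
    (t *+ (i != j) * x k 0 * x l 0) = t *+ (i != j) * x a 0 * x b 0.
  rewrite (bigD1 b)//= (bigD1 a)//= !eqxx mul1r !big1 ?addr0//.
    by move=> l /negbTE lb; rewrite big1// => k _; rewrite lb andbF mul0r.
  by move=> k /negbTE ->; rewrite /= mul0r.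
by rewrite !pick; case: (i != j) => /=; ring.
Qed.

Lemma posdef_probe_mx (R : realType) (n : nat) (y : 'I_n -> R) (i j : 'I_n)
    (t : R) :
  (forall k, 0 < y k) -> t ^+ 2 < y i * y j -> posdef (probe_mx y i j t 0).
Proof.
move=> y0 tij; split; first exact: probe_mxT.
move=> x xn0; rewrite quad_probe_mx.
have sq_ge0 k : 0 <= y k * x k 0 ^+ 2 by rewrite mulr_ge0 ?sqr_ge0// ltW.
have diag_gt0 : 0 < \sum_k y k * x k 0 ^+ 2.
  rewrite lt_neqAle sumr_ge0// andbT eq_sym; apply: contra xn0 => /eqP sum0.
  apply/eqP/matrixP => k l; rewrite ord1 mxE.
  have /eqP := psumr_eq0P (fun k _ => sq_ge0 k) sum0 (i := k) isT.
  by rewrite mulf_eq0 gt_eqF//= sqrf_eq0 => /eqP.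
have [->|ij] := eqVneq i j; first by rewrite addr0.
have [xj0|xj0] := eqVneq (x j 0) 0; first by rewrite xj0 mulr0 mul0rn addr0.
rewrite (bigD1 i)//= (bigD1 j) 1?eq_sym//=.
set rest := \sum_(_ | _) _.
have rest_ge0 : 0 <= rest by rewrite sumr_ge0.
(* Multiplying by [y i] > 0 allows completing the square without division. *)
rewrite -(pmulr_rgt0 _ (y0 i)).
have -> : y i * (y i * x i 0 ^+ 2 + (y j * x j 0 ^+ 2 + rest) +
   t * x i 0 * x j 0 *+ 2 *+ true) =
   (y i * x i 0 + t * x j 0) ^+ 2 + (y i * y j - t ^+ 2) * x j 0 ^+ 2 + y i * rest.
  by rewrite mulr1n; ring.
rewrite ltr_wpDr ?(mulr_ge0 (ltW _))// ltr_wpDl ?sqr_ge0//.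
by rewrite mulr_gt0 ?subr_gt0// exprn_even_gt0.
Qed.

(** Since [s] is real, it disappears from the imaginary part. The common off-diagonal value can thus
    be any real number. *)
Lemma upper_probe_mx (R : realType) (n : nat) (z : 'I_n -> R[i]) (i j : 'I_n)
    (t : R[i]) (s : R) :
  (forall k, 0 < complex.Im (z k)) ->
  complex.Im t ^+ 2 < complex.Im (z i) * complex.Im (z j) ->
  posdef (map_mx (@complex.Im R) (probe_mx z i j t s%:C%C)).
Proof.
move=> z0 tij; have := @posdef_probe_mx _ _ (fun k => complex.Im (z k)) i j _ z0 tij.
congr posdef; apply/matrixP => k l; rewrite !mxE.
by case: eqP => // _; case: ifP.
Qed.

(** * Monomials of degree at most 2 *)

(** Splits one factor off a monomial. The new exponents do not depend on [x], so repeated use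
    identifies the whole monomial when its degree is small. *)
Lemma prod_exp_pos (K : comNzRingType) (I : finType) (a : I -> nat) (i : I) :
  (0 < a i)%N ->
  exists a' : I -> nat,
    [/\ (\sum_k a k = (\sum_k a' k).+1)%N,
        forall k, (a' k = a k - (k == i))%N
      & forall x : I -> K,
          \prod_k x k ^+ a k = x i * \prod_k x k ^+ a' k].
Proof.
move=> ai; exists (fun k => (a k - (k == i))%N); split=> // [|x].
  rewrite (bigD1 i)//= [in RHS](bigD1 i)//= eqxx -addSn subn1 prednK//.
  by congr addn; apply: eq_bigr => k /negbTE ->; rewrite subn0.
rewrite (bigD1 i)//= [in RHS](bigD1 i)//= eqxx mulrA -exprS subn1 prednK//.
by congr (_ * _); apply: eq_bigr => k /negbTE ->; rewrite subn0.
Qed.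

Lemma prod_exp0 (K : comNzRingType) (I : finType) (a : I -> nat) (x : I -> K) :
  (\sum_k a k = 0)%N -> \prod_k x k ^+ a k = 1.
Proof.
move=> /eqP; rewrite sum_nat_eq0 => /forallP a0.
by rewrite big1// => k _; rewrite (eqP (a0 k)).
Qed.

Lemma sum_pos_exists (I : finType) (a : I -> nat) :
  (0 < \sum_k a k)%N -> exists i, (0 < a i)%N.
Proof.
rewrite lt0n sum_nat_eq0 negb_forall => /existsP[i ai].
by exists i; rewrite lt0n.
Qed.

Lemma prod_exp1 (K : comNzRingType) (I : finType) (a : I -> nat) :
  (\sum_k a k = 1)%N ->
  exists2 i, (0 < a i)%N & forall x : I -> K, \prod_k x k ^+ a k = x i.
Proof.
move=> suma; have [|i ai] := @sum_pos_exists I a; first by rewrite suma.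
exists i => // x; have [a' [sa _ ->]] := @prod_exp_pos K I a i ai.
by rewrite prod_exp0 ?mulr1//; apply: succn_inj; rewrite -sa.
Qed.

Lemma prod_exp2 (K : comNzRingType) (I : finType) (a : I -> nat) :
  (\sum_k a k = 2)%N ->
  exists i j, forall x : I -> K, \prod_k x k ^+ a k = x i * x j.
Proof.
move=> suma; have [|i ai] := @sum_pos_exists I a; first by rewrite suma.
have [a' [sa _ prodE]] := @prod_exp_pos K I a i ai.
have [|j _ prod'E] := @prod_exp1 K I a'.
  by apply: succn_inj; rewrite -sa.
by exists i, j => x; rewrite prodE prod'E.
Qed.

(** * Stable pairs and their diagonal degrees *)

Lemma Im_inv_gt0 (R : realType) (w : R[i]) :
  0 < complex.Im w -> 0 < complex.Im (- w^-1).
Proof.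
case: w => x y /= y0; rewrite opprK divr_gt0//.
by rewrite ltr_wpDl ?sqr_ge0// exprn_gt0.
Qed.

Definition diag_deg {n : nat} (a : 'I_n -> nat) : nat := (\sum_k a k)%N.

Definition offdiag_deg {n : nat} (e : 'I_n -> 'I_n -> nat) : nat :=
  (\sum_(k < n) \sum_(l < n | (k < l)%N) e k l)%N.

(** Stability of c1 Z^a + c2 Z^b Q, stated through values at matrices. This is what is left of f
    after removing the common diagonal monomial, with the term free of off-diagonal variables put
    first. *)
Definition stable_pair {R : realType} {n : nat} (c1 c2 : R[i])
    (a b : 'I_n -> nat) (e : 'I_n -> 'I_n -> nat) : Prop :=
  forall M : 'M[R[i]]_n,
    M^T = M -> posdef (map_mx (@complex.Im R) M) ->
    c1 * (\prod_k M k k ^+ a k) +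
    c2 * ((\prod_k M k k ^+ b k) *
          \prod_(k < n) \prod_(l < n | (k < l)%N) M k l ^+ e k l) != 0.

(** Writing the special entry as [s * t] makes the product homogeneous in [s]. *)
Lemma offdiag_prod_probe_mx (K : comNzRingType) (n : nat) (z : 'I_n -> K)
    (e : 'I_n -> 'I_n -> nat) (i j : 'I_n) (t s : K) :
  (i < j)%N ->
  \prod_(k < n) \prod_(l < n | (k < l)%N) probe_mx z i j (s * t) s k l ^+ e k l
  = s ^+ offdiag_deg e * t ^+ e i j.
Proof.
move=> ij; rewrite expr_sum.
transitivity (\prod_(k < n) (s ^+ (\sum_(l < n | (k < l)%N) e k l) *
   \prod_(l < n | (k < l)%N) (if (k, l) == (i, j) then t ^+ e i j else 1))).
  apply: eq_bigr => k _; rewrite expr_sum -big_split; apply: eq_bigr => l kl.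
  rewrite /= mxE -val_eqE /= ltn_eqF// !xpair_eqE.
  case: (boolP ((k == i) && (l == j))) => [/andP[/eqP-> /eqP->]|_] /=.
    by rewrite exprMn.
  rewrite mulr1; case: (boolP ((k == j) && (l == i))) => // /andP[/eqP kj /eqP li].
  by move: kl; rewrite kj li ltnNge ltnW.
rewrite big_split /=; congr (_ * _).
rewrite (bigD1 i)//= (bigD1 j)//= eqxx !big1 ?mulr1//.
  by move=> k /negbTE ki; rewrite big1// => l _; rewrite xpair_eqE ki.
by move=> l /andP[_ /negbTE lj]; rewrite xpair_eqE lj andbF.
Qed.

Lemma stable_pair_probe (R : realType) (n : nat) (c1 c2 : R[i])
    (a b : 'I_n -> nat) (e : 'I_n -> 'I_n -> nat) (z : 'I_n -> R[i])
    (i j : 'I_n) (t : R[i]) (s : R) :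
  stable_pair c1 c2 a b e ->
  (i < j)%N -> (forall k, 0 < complex.Im (z k)) ->
  complex.Im (s%:C%C * t) ^+ 2 < complex.Im (z i) * complex.Im (z j) ->
  c1 * (\prod_k z k ^+ a k) +
  c2 * ((\prod_k z k ^+ b k) * (s%:C%C ^+ offdiag_deg e * t ^+ e i j)) != 0.
Proof.
move=> stab ij z0 tij.
have := stab _ (probe_mxT z i j (s%:C%C * t) s%:C%C) (upper_probe_mx s z0 tij).
rewrite offdiag_prod_probe_mx//.
congr (_ * _ + _ * (_ * _) != 0);
  by apply: eq_bigr => k _; rewrite mxE eqxx.
Qed.

Lemma stable_pair_upper (R : realType) (n : nat) (c1 c2 : R[i])
    (a b : 'I_n -> nat) (e : 'I_n -> 'I_n -> nat) (k0 : 'I_n) (w : R[i]) :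
  stable_pair c1 c2 a b e -> (forall k, a k = 0%N \/ b k = 0%N) -> c2 != 0 ->
  0 < complex.Im w ->
  w ^+ (diag_deg a + diag_deg b) != - (c1 / c2) * (-1) ^+ diag_deg a.
Proof.
(* By disjointness Z^b only meets the value w and Z^a only meets -1/w. Ones off the diagonal make Q
   equal to 1. *)
move=> stab disj c2_neq0 w0; pose z k := if a k == 0%N then w else - w^-1.
have z0 k : 0 < complex.Im (z k).
  by rewrite /z; case: ifP => // _; exact: Im_inv_gt0.
have k0_dom : complex.Im (1 : R[i]) ^+ 2 < complex.Im (z k0) * complex.Im (z k0).
  by rewrite /= expr0n/= mulr_gt0.
have := stab _ (probe_mxT z k0 k0 1 1) (upper_probe_mx 1 z0 k0_dom).
have -> : \prod_k probe_mx z k0 k0 1 1 k k ^+ a k = (- w^-1) ^+ diag_deg a.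
  rewrite expr_sum; apply: eq_bigr => k _; rewrite mxE eqxx /z.
  by case: eqP => // ->; rewrite !expr0.
have -> : \prod_k probe_mx z k0 k0 1 1 k k ^+ b k = w ^+ diag_deg b.
  rewrite expr_sum; apply: eq_bigr => k _; rewrite mxE eqxx /z.
  by case: eqP => // ak0; have [//|->] := disj k; rewrite !expr0.
rewrite [X in _ * (_ * X)]big1 ?mulr1; last first.
  move=> k _; rewrite big1// => l kl; rewrite mxE if_same.
  by rewrite -val_eqE /= ltn_eqF// expr1n.
have w_neq0 : w != 0 by apply: contraTneq w0 => ->; rewrite ltxx.
apply: contra_neq; rewrite exprD (exprNn w^-1) exprVn => wE.
have -> : w ^+ diag_deg b = - (c1 / c2) * (-1) ^+ diag_deg a / w ^+ diag_deg a.
  by rewrite -wE mulrAC divff ?mul1r// expf_neq0.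
by field; rewrite expf_neq0.
Qed.

Lemma stable_pair_deg_le2 (R : realType) (n : nat) (c1 c2 : R[i])
    (a b : 'I_n -> nat) (e : 'I_n -> 'I_n -> nat) :
  stable_pair c1 c2 a b e -> (forall k, a k = 0%N \/ b k = 0%N) ->
  c1 != 0 -> c2 != 0 ->
  (diag_deg a + diag_deg b <= 2)%N.
Proof.
move=> stab disj c1_neq0 c2_neq0; rewrite leqNgt; apply/negP => deg_gt2.
have [k0 _] : exists k, (0 < a k + b k)%N.
  by apply: sum_pos_exists; rewrite big_split; apply: leq_trans deg_gt2.
have s_neq0 : - (c1 / c2) * (-1) ^+ diag_deg a != 0.
  by rewrite mulf_neq0 ?expf_neq0 ?oppr_eq0 ?oner_eq0// mulf_neq0 ?invr_eq0.
have [w w0 /eqP] := upper_root deg_gt2 s_neq0.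
apply/negP; apply: stable_pair_upper k0 _ stab disj c2_neq0 _.
by rewrite -ltcR complexIm.
Qed.

(** A number that is not a nonnegative real has a square root in the upper half plane. The sign
    (-1)^A separates two terms of degree 1 from a constant and a term of degree 2. *)
Lemma stable_pair_deg2_sign (R : realType) (n : nat) (c1 c2 : R[i])
    (a b : 'I_n -> nat) (e : 'I_n -> 'I_n -> nat) :
  stable_pair c1 c2 a b e -> (forall k, a k = 0%N \/ b k = 0%N) ->
  c2 != 0 -> (diag_deg a + diag_deg b = 2)%N ->
  0 <= - (c1 / c2) * (-1) ^+ diag_deg a.
Proof.
move=> stab disj c2_neq0 deg2; rewrite -[_ <= _]negbK; apply/negP.
have [k0 _] : exists k, (0 < a k + b k)%N.
  by apply: sum_pos_exists; rewrite big_split /= -[X in (_ < X)%N]/(diag_deg a + diag_deg b)%N deg2.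
move=> /upper_sqrt[w w0]; rewrite -deg2 => /eqP.
apply/negP; apply: stable_pair_upper k0 _ stab disj c2_neq0 _.
by rewrite -ltcR complexIm.
Qed.

(** * Off-diagonal variables of a stable pair *)

Lemma Im_sqr_le_norm (R : realType) (x : R[i]) :
  (complex.Im x ^+ 2)%:C%C <= `|x| ^+ 2.
Proof. by rewrite -add_Re2_Im2 lecR lerDr sqr_ge0. Qed.

(** Take x = c + 1 if p < q, and its inverse if q < p. This supplies the large or small scale L. *)
Lemma exists_expr_lt (R : realFieldType) (c : R) (p q : nat) :
  0 <= c -> p != q -> exists2 x : R, 0 < x & c * x ^+ p < x ^+ q.
Proof.
move=> c0; have c1_gt0 : 0 < c + 1 by rewrite ltr_wpDl.
have c1_ge1 : 1 <= c + 1 by rewrite lerDr.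
rewrite neq_ltn => /orP[pq|qp].
  exists (c + 1) => //; apply: (@lt_le_trans _ _ ((c + 1) ^+ p.+1)).
    by rewrite exprS ltr_pM2r ?exprn_gt0// ltrDl.
  exact: ler_weXn2l.
exists (c + 1)^-1; first by rewrite invr_gt0.
rewrite -(subnKC (ltnW qp)) exprD mulrCA gtr_pMr ?exprn_gt0 ?invr_gt0//.
apply: (@le_lt_trans _ _ (c * (c + 1)^-1)).
  apply: ler_wpM2l => //; rewrite -[leRHS]expr1 ler_wiXn2l ?subn_gt0//.
    by rewrite invr_ge0 ltW.
  by rewrite invf_le1.
by rewrite ltr_pdivrMr// mul1r ltrDl.
Qed.

Lemma stable_pair_offdiag_deg (R : realType) (n : nat) (c1 c2 : R[i])
    (a b : 'I_n -> nat) (e : 'I_n -> 'I_n -> nat) (i j : 'I_n) :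
  stable_pair c1 c2 a b e -> c2 != 0 -> (i < j)%N -> (0 < e i j)%N ->
  diag_deg a = (diag_deg b + offdiag_deg e)%N.
Proof.
move=> stab c2_neq0 ij eij; apply/eqP; rewrite -[_ == _]negbK; apply/negP.
have [k k0 kE] : exists2 k : R, 0 <= k & `|c1 / c2| = k%:C%C.
  have /complex_realP[k kE] := normr_real (c1 / c2).
  by exists k => //; rewrite -ler0c -kE.
case/(exists_expr_lt k0) => L L0 L_lt.
pose z (l : 'I_n) := Complex 0 L.
have zE : Complex 0 L = L%:C%C * 'i by rewrite -complexiE; simpc.
have z0 : Complex 0 L != 0 by rewrite eq_complex /= eqxx gt_eqF.
(* The solution of f = 0 when all diagonal entries are L i, the off-diagonal ones L, and the entry
   at (i, j) is L t. *)
pose t := (e i j).-root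
  (- (c1 / c2) * Complex 0 L ^+ diag_deg a /
     (Complex 0 L ^+ diag_deg b * L%:C%C ^+ offdiag_deg e)).
have LC0 : L%:C%C != 0 by rewrite eq_complex /= eqxx gt_eqF.
have L_gt0 : 0 < L%:C%C by rewrite ltcR.
have normL : `|L%:C%C| = L%:C%C by rewrite gtr0_norm.
have norm_z : `|Complex 0 L| = L%:C%C by rewrite zE normrM normCi mulr1.
(* The choice of L says |c1/c2| L^A < L^(B+E), that is, |t|^(e i j) < 1. *)
have t_lt1 : `|t| < 1.
  rewrite -(expr_lt1 eij)// -normrX rootCK// 2!normrM normrN kE normfV normrM.
  rewrite !normrX norm_z normL -exprD ltr_pdivrMr ?exprn_gt0// mul1r.
  by rewrite -!rmorphXn -rmorphM ltcR.
have t_dom : complex.Im (L%:C%C * t) ^+ 2 < L * L.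
  have -> : complex.Im (L%:C%C * t) = L * complex.Im t by case: (t) => x y; simpc.
  rewrite exprMn -expr2 gtr_pMr ?exprn_gt0// -ltcR.
  apply: (@le_lt_trans _ _ (`|t| ^+ 2)); first exact: Im_sqr_le_norm.
  by rewrite expr_lt1.
have := @stable_pair_probe _ _ _ _ _ _ _ z i j t L stab ij (fun _ => L0) t_dom.
rewrite -!expr_sum -/(diag_deg a) -/(diag_deg b) rootCK// => /eqP; apply.
by field; rewrite c2_neq0 !expf_neq0.
Qed.

Lemma stable_pair_offdiag_supp (R : realType) (n : nat) (c1 c2 : R[i])
    (a b : 'I_n -> nat) (e : 'I_n -> 'I_n -> nat) (i j p : 'I_n) :
  stable_pair c1 c2 a b e -> c2 != 0 -> (i < j)%N -> (0 < e i j)%N ->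
  diag_deg b = 0%N -> p \in [:: i; j] -> (0 < a p)%N.
Proof.
move=> stab c2_neq0 ij eij b0 pij; rewrite lt0n; apply/negP => /eqP ap0.
(* [t] solves f = 0 with i on the diagonal and ones elsewhere off it. Raising entry p to L i changes
   neither diagonal monomial, and L is chosen to exceed (Im t)^2. *)
pose t := (e i j).-root (- (c1 / c2) * Complex 0 1 ^+ diag_deg a).
pose L := 1 + complex.Im t ^+ 2.
have L_ge1 : 1 <= L by rewrite lerDl sqr_ge0.
pose z (k : 'I_n) : R[i] := Complex 0 (if k == p then L else 1).
have z0 k : 0 < complex.Im (z k).
  by rewrite /z /=; case: ifP => // _; exact: lt_le_trans L_ge1.
have t_dom : complex.Im (1%:C%C * t) ^+ 2 < complex.Im (z i) * complex.Im (z j).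
  rewrite mul1r; apply: (@lt_le_trans _ _ L); first by rewrite ltrDr.
  rewrite /z /=; move: pij; rewrite !inE => /orP[]/eqP->; rewrite eqxx.
    by case: ifP => _; [rewrite ler_peMl// (le_trans _ L_ge1)|rewrite mulr1].
  by case: ifP => _; [rewrite ler_peMl// (le_trans _ L_ge1)|rewrite mul1r].
have := stable_pair_probe stab ij z0 t_dom.
have -> : \prod_k z k ^+ a k = Complex 0 1 ^+ diag_deg a.
  rewrite expr_sum; apply: eq_bigr => k _; rewrite /z.
  by case: eqP => // ->; rewrite ap0 !expr0.
rewrite prod_exp0// expr1n !mul1r rootCK// => /eqP; apply.
by field.
Qed.

Lemma stable_pair_offdiag (R : realType) (n : nat) (c1 c2 : R[i])
    (a b : 'I_n -> nat) (e : 'I_n -> 'I_n -> nat) (i j : 'I_n)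
    (K : comNzRingType) (x : 'I_n -> K) (y : 'I_n -> 'I_n -> K) :
  stable_pair c1 c2 a b e -> (forall k, a k = 0%N \/ b k = 0%N) ->
  c1 != 0 -> c2 != 0 -> (i < j)%N -> (0 < e i j)%N ->
  [/\ diag_deg a = 2%N, diag_deg b = 0%N, \prod_k x k ^+ a k = x i * x j
    & \prod_(k < n) \prod_(l < n | (k < l)%N) y k l ^+ e k l = y i j ^+ 2].
Proof.
move=> stab disj c1_neq0 c2_neq0 ij eij.
have deg_le2 := stable_pair_deg_le2 stab disj c1_neq0 c2_neq0.
have degE := stable_pair_offdiag_deg stab c2_neq0 ij eij.
have eijE : (e i j <= offdiag_deg e)%N.
  by rewrite /offdiag_deg (bigD1 i)//= (bigD1 j)//= -addnA leq_addr.
(* The two degree relations give 2B + E <= 2, while E >= 1. *)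
have b0 : diag_deg b = 0%N by lia.
have supp (k l : 'I_n) : (k < l)%N -> (0 < e k l)%N -> (0 < a k)%N && (0 < a l)%N.
  move=> kl ekl.
  by rewrite !(stable_pair_offdiag_supp stab c2_neq0 kl ekl b0)// !inE eqxx ?orbT.
have /andP[ai aj] := supp _ _ ij eij.
have ji : (j == i) = false by rewrite -val_eqE gtn_eqF.
have [a1 [deg_a a1E prod_a]] := prod_exp_pos K ai.
have a1j : (0 < a1 j)%N by rewrite a1E ji subn0.
have [a2 [deg_a1 a2E prod_a1]] := prod_exp_pos K a1j.
have deg_a2 : (\sum_k a2 k = 0)%N by move: deg_le2; rewrite /diag_deg; lia.
have degaE : diag_deg a = 2%N by rewrite /diag_deg deg_a deg_a1 deg_a2.
(* Both i and j lie in the support of [a], so A <= 2 leaves degree 0 for all other variables. *)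
have a_supp k : (0 < a k)%N -> (k == i) || (k == j).
  move/eqP: deg_a2; rewrite sum_nat_eq0 => /forallP/(_ k)/implyP/(_ isT).
  by rewrite a2E a1E; case: (k == i); case: (k == j) => //; lia.
(* Any off-diagonal variable of Q has both indices in the support {i, j} of [a], and k < l fixes
   their order. *)
have e_supp (k l : 'I_n) : (k < l)%N -> (k, l) != (i, j) -> e k l = 0%N.
  move=> kl; apply: contraNeq; rewrite -lt0n => /(supp _ _ kl)/andP[/a_supp + /a_supp].
  rewrite xpair_eqE -!val_eqE /=.
  by move: kl ij; lia.
have e2 : e i j = 2%N.
  have : offdiag_deg e = 2%N by lia.
  rewrite /offdiag_deg (bigD1 i)//= (bigD1 j)//= !big1 ?addn0//.
    move=> k ki; rewrite big1// => l kl; rewrite e_supp// xpair_eqE negb_and ki//.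
  by move=> l /andP[il lj]; rewrite e_supp// xpair_eqE negb_and lj orbT.
split=> //; first by rewrite prod_a prod_a1 prod_exp0// mulr1.
rewrite (bigD1 i)//= (bigD1 j)//= e2 !big1 ?mulr1//.
  move=> k ki; rewrite big1// => l kl; rewrite e_supp// xpair_eqE negb_and ki//.
by move=> l /andP[il lj]; rewrite e_supp// xpair_eqE negb_and lj orbT.
Qed.

(** * Monomials and exponent matrices *)

(** Reindexing ranks by pairs i <= j and separating i = j from i < j turns a multi-exponent into
    matrix form. *)
Lemma mpolyX_zvar (R : realType) (n : nat) (m : 'X_{1..nvar n}) :
  'X_[m] = (\prod_i zvar R i i ^+ m (zidx i i)) *
    \prod_(i < n) \prod_(j < n | (i < j)%N) zvar R i j ^+ m (zidx i j) :> polyZ R n.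
Proof.
rewrite mpolyXE_id (reindex enum_rank) /=; last by apply: onW_bij; exact: enum_rank_bij.
pose F (q : 'I_n * 'I_n) : polyZ R n := zvar R q.1 q.2 ^+ m (zidx q.1 q.2).
transitivity (\prod_(p : upair n) F (val p)).
  apply: eq_bigr => -[[i j] /= ij] _.
  suff -> : enum_rank (exist _ (i, j) ij : upair n) = zidx i j by [].
  by congr enum_rank; apply: val_inj; rewrite /= /sort_pair ij.
transitivity (\prod_(q : 'I_n * 'I_n | (q.1 <= q.2)%N) F q).
  by rewrite (big_sub (fun q : 'I_n * 'I_n => (q.1 <= q.2)%N)).
transitivity (\prod_(i < n) \prod_(j < n | (i <= j)%N) F (i, j)).
  by rewrite pair_big_dep; apply: eq_big => [[]|[]].
rewrite -big_split; apply: eq_bigr => i _ /=; rewrite (bigD1 i)//=; congr (_ * _).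
by apply: eq_bigl => j; rewrite ltn_neqAle andbC eq_sym.
Qed.

Lemma Zmon_diag (R : realType) (n : nat) (u : 'I_n -> nat) :
  Zmon R (diag_mx (\row_k (u k)%:R)) = \prod_k zvar R k k ^+ u k.
Proof.
rewrite /Zmon [X in _ * X]big1 ?mulr1.
  by apply: eq_bigr => k _; rewrite !mxE eqxx mulr1n Num.Theory.natrK.
move=> i _; rewrite big1// => j ij; rewrite !mxE -val_eqE ltn_eqF//= mulr0n mulr0.
Qed.

Lemma is_exponent_diag (n : nat) (u : 'I_n -> nat) :
  is_exponent (diag_mx (\row_k (u k)%:R)).
Proof.
split.
- exact: tr_diag_mx.
- by move=> i j; rewrite !mxE mulrn_wge0.
- by move=> i; rewrite !mxE eqxx mulr1n; exact: intr_nat.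
- by move=> i j /negbTE ij; rewrite !mxE ij mulr0n mulr0.
Qed.

Lemma norm1_diag_sub (n : nat) (u v : 'I_n -> nat) :
  norm1 (diag_mx (\row_k (u k)%:R) - diag_mx (\row_k (v k)%:R))
    <= (diag_deg u + diag_deg v)%:R.
Proof.
rewrite /diag_deg -big_split natr_sum; apply: ler_sum => i _.
rewrite (bigD1 i)//= big1 ?addr0.
  rewrite !mxE eqxx !mulr1n natrD (le_trans (ler_normB _ _))//.
  by rewrite !normr_nat.
by move=> j ji; rewrite !mxE eq_sym (negbTE ji) !mulr0n subr0 normr0.
Qed.

(** * Absence of common factors *)

Lemma no_common_factor1l (R : realType) (n : nat) (p : polyZ R n) :
  no_common_factor 1 p.
Proof. by move=> g h k gh _; apply/unitrPr; exists h. Qed.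

Lemma no_common_factorC (R : realType) (n : nat) (p q : polyZ R n) :
  no_common_factor p q -> no_common_factor q p.
Proof. by move=> pq g h k qE pE; exact: pq pE qE. Qed.

Lemma no_common_factor_zvar (R : realType) (n : nat) (i j : 'I_n) :
  i != j -> no_common_factor (zvar R i i) (zvar R j j).
Proof.
move=> ij g h k gh gk.
have zij : zidx i i != zidx j j.
  apply: contra ij; rewrite (inj_eq enum_rank_inj) -val_eqE /= /sort_pair !leqnn.
  by rewrite xpair_eqE andbb.
have [g0 h0] : g != 0 /\ h != 0.
  apply/andP; rewrite -negb_or -mulf_eq0 -gh.
  by rewrite -msize_poly_eq0 msizeX.
(* [msize] is the degree plus one, so in z_ii = g h one factor is a nonzero constant. *)
have aux (p q : nat) : (p != 0 -> q != 0 -> 2 = (p + q).-1 ->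
  (p == 1) || (q == 1))%N by lia.
have /orP[] : (msize g == 1%N) || (msize h == 1%N).
  apply: aux; rewrite ?msize_poly_eq0//.
  by have := msizeM g0 h0; rewrite -gh msizeX mdeg1.
  case/msize_poly1P => c c0 ->; apply/unitrPr; exists (c^-1)%:MP.
  by rewrite -mpolyCM divff.
case/msize_poly1P => c c0 hE.
(* If [h] is constant, then [g] vanishes with z_ii at this point, whereas z_jj = g k takes the value
   1 there. *)
pose v l : R[i] := (l == zidx j j)%:R.
have gv0 : g.@[v] = 0.
  have := congr1 (meval v) gh; rewrite mevalXU hE mevalM mevalC /v (negbTE zij).
  by move/esym/eqP; rewrite mulf_eq0 (negbTE c0) orbF => /eqP.
have := congr1 (meval v) gk; rewrite mevalXU mevalM gv0 mul0r /v eqxx => /eqP.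
by rewrite oner_eq0.
Qed.

(** * Evaluation and the term without off-diagonal variables *)

Lemma zeval_mpolyX (R : realType) (n : nat) (M : 'M[R[i]]_n)
    (m : 'X_{1..nvar n}) :
  M^T = M -> zeval M ('X_[m] : polyZ R n) =
    (\prod_k M k k ^+ m (zidx k k)) *
    \prod_(k < n) \prod_(l < n | (k < l)%N) M k l ^+ m (zidx k l).
Proof.
move=> symM; have zE k l := zeval_zvar k l symM.
rewrite mpolyX_zvar /zeval mevalM !rmorph_prod; congr (_ * _).
  by apply: eq_bigr => k _; rewrite rmorphXn /= -zE.
apply: eq_bigr => k _; rewrite rmorph_prod; apply: eq_bigr => l _.
by rewrite rmorphXn /= -zE.
Qed.

Lemma prod_exp_split (K : comNzRingType) (I : finType) (g u : I -> nat)
    (x : I -> K) :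
  (forall k, g k <= u k)%N ->
  \prod_k x k ^+ u k = (\prod_k x k ^+ g k) * \prod_k x k ^+ (u k - g k).
Proof.
by move=> gu; rewrite -big_split; apply: eq_bigr => k _; rewrite /= -exprD subnKC.
Qed.

Lemma zeval_imag_offdiag (R : realType) (n : nat) (m : 'X_{1..nvar n})
    (i j : 'I_n) :
  (i < j)%N -> (0 < m (zidx i j))%N ->
  zeval (Complex 0 1)%:M ('X_[m] : polyZ R n) = 0.
Proof.
move=> ij mij; rewrite zeval_mpolyX ?tr_scalar_mx//.
have Mij : (Complex 0 1)%:M i j = 0 :> R[i].
  by rewrite mxE -val_eqE ltn_eqF.
rewrite [X in _ * X](bigD1 i)//= [X in _ * (X * _)](bigD1 j)//= Mij expr0n.
by rewrite eqn0Ngt mij !(mul0r, mulr0).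
Qed.

(** If both monomials had an off-diagonal variable, f would vanish at iI. The terms may have to be
    swapped, so the support is only given as a set. *)
Lemma binomial_diag_term (R : realType) (n : nat) (f : polyZ R n) :
  binomial_poly f -> psd_stable f ->
  exists (c1 c2 : R[i]) (m1 m2 : 'X_{1..nvar n}),
    [/\ c1 != 0, c2 != 0, m1 != m2 & f = c1 *: 'X_[m1] + c2 *: 'X_[m2]] /\
    (msupp f =i [:: m1; m2] /\
     forall i j : 'I_n, (i < j)%N -> m1 (zidx i j) = 0%N).
Proof.
move=> bin stab.
have [m1 [m2 E]] : exists m1 m2, msupp f = [:: m1; m2].
  move: bin; rewrite /binomial_poly; case: (msupp f) => [|m1 [|m2 [|? ?]]]//.
  by exists m1, m2.
have fE : f = f@_m1 *: 'X_[m1] + f@_m2 *: 'X_[m2].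
  by rewrite {1}[f]mpolyE E big_cons big_seq1.
have c1_neq0 : f@_m1 != 0 by rewrite -mcoeff_msupp E inE eqxx.
have c2_neq0 : f@_m2 != 0 by rewrite -mcoeff_msupp E !inE eqxx orbT.
have neq : m1 != m2 by have := msupp_uniq f; rewrite E /= inE andbT.
have [d1|] := boolP [forall i : 'I_n, forall j : 'I_n,
  (i < j)%N ==> (m1 (zidx i j) == 0%N)].
  exists f@_m1, f@_m2, m1, m2; split=> //; split=> [m|]; first by rewrite E.
  by move=> i j ij; have /forallP/(_ i)/forallP/(_ j)/implyP/(_ ij)/eqP := d1.
have [d2 _|] := boolP [forall i : 'I_n, forall j : 'I_n,
  (i < j)%N ==> (m2 (zidx i j) == 0%N)].
  exists f@_m2, f@_m1, m2, m1; split.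
    by split=> //; rewrite 1?eq_sym 1?addrC.
  split=> [m|]; first by rewrite E !inE orbC.
  by move=> i j ij; have /forallP/(_ i)/forallP/(_ j)/implyP/(_ ij)/eqP := d2.
rewrite !negb_forall => /existsP[i2]; rewrite negb_forall => /existsP[j2].
rewrite negb_imply -lt0n => /andP[ij2 m2_gt0].
move=> /existsP[i1]; rewrite negb_forall => /existsP[j1].
rewrite negb_imply -lt0n => /andP[ij1 m1_gt0].
have : zeval (Complex 0 1)%:M f != 0.
  apply: stab; first exact: tr_scalar_mx.
  (* The matrix iI is the test matrix with i on the diagonal and zeros off it. *)
  have := @upper_probe_mx R n (fun=> Complex 0 1) i1 j1 0 0 (fun=> ltr01).
  rewrite /= expr0n mul1r => /(_ ltr01); congr posdef.
  apply/matrixP => k l; rewrite !mxE if_same.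
  by case: eqP.
by rewrite fE /zeval mevalD !mevalZ -!/(zeval _ _)
  (zeval_imag_offdiag _ ij1)// (zeval_imag_offdiag _ ij2)// !mulr0 addr0 eqxx.
Qed.

(** * Classification of the psd-stable binomials *)

(* The sets {Z^a1, Z^a2} are compared by =i (same members).  In the order of
   R[i], 0 <= c and c < 0 include that c is real. *)
Theorem theorem5p5 (R : realType) (n : nat) (f : polyZ R n) :
  binomial_poly f -> psd_stable f ->
  exists (c1 c2 : R[i]) (g : 'M[rat]_n),
    [/\ c1 != 0, c2 != 0, is_exponent g & is_diag_mx g] /\
    ( (only_diag_vars f /\
       exists a1 a2 : 'M[rat]_n,
         [/\ is_exponent a1, is_exponent a2
           & f = Zmon R g * (c1 *: Zmon R a1 + c2 *: Zmon R a2)] /\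
         [/\ no_common_factor (Zmon R a1) (Zmon R a2),
             norm1 (a1 - a2) <= 2,
             a1 != 0 \/ a2 != 0
           & [\/ exists i : 'I_n,
                   [:: Zmon R a1; Zmon R a2] =i [:: 1; zvar R i i],
                 exists i j : 'I_n,
                   [:: Zmon R a1; Zmon R a2] =i [:: zvar R i i; zvar R j j]
                   /\ 0 <= c1 / c2
               | exists i j : 'I_n,
                   [:: Zmon R a1; Zmon R a2]
                     =i [:: 1; zvar R i i * zvar R j j]
                   /\ c1 / c2 < 0]])
      \/
      (exists i j : 'I_n,
         [/\ (i < j)%N,
             f = Zmon R g * (c1 *: (zvar R i i * zvar R j j)
                             + c2 *: zvar R i j ^+ 2)
           & c1 / c2 \is Num.real]) ).
Proof.
move=> bin stab; have := binomial_diag_term bin stab.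
move=> [c1 [c2 [m1 [m2 [[c1_neq0 c2_neq0 m12 fE] [suppE diag1]]]]]].
pose d1 k := m1 (zidx k k); pose d2 k := m2 (zidx k k).
(* The common diagonal monomial; the remaining exponents [a] and [b] have disjoint supports. *)
pose g k := minn (d1 k) (d2 k).
pose a k := (d1 k - g k)%N; pose b k := (d2 k - g k)%N.
pose e (k l : 'I_n) := m2 (zidx k l).
have disj k : a k = 0%N \/ b k = 0%N by rewrite /a /b /g; lia.
pose D (u : 'I_n -> nat) := diag_mx (\row_k (u k)%:R) : 'M[rat]_n.
have g1 k : (g k <= d1 k)%N by exact: geq_minl.
have g2 k : (g k <= d2 k)%N by exact: geq_minr.
have X1 : 'X_[m1] = Zmon R (D g) * Zmon R (D a).
  rewrite mpolyX_zvar [X in _ * X]big1 ?mulr1; last first.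
    by move=> i _; rewrite big1// => j ij; rewrite diag1.
  by rewrite !Zmon_diag; exact: prod_exp_split.
have X2 : 'X_[m2] = Zmon R (D g) * (Zmon R (D b) *
    \prod_(k < n) \prod_(l < n | (k < l)%N) zvar R k l ^+ e k l).
  by rewrite mpolyX_zvar mulrA !Zmon_diag (prod_exp_split _ g2).
have stab' : stable_pair c1 c2 a b e.
  move=> M symM /(stab _ symM); rewrite fE /zeval mevalD !mevalZ -!/(zeval _ _).
  rewrite !zeval_mpolyX// [X in c1 * (_ * X)]big1 ?mulr1; last first.
    by move=> i _; rewrite big1// => j ij; rewrite diag1.
  rewrite (prod_exp_split _ g1) (prod_exp_split _ g2).
  (* A zero of the quotient is a zero of f. *)
  apply: contra_neq => eq0.
  by rewrite -!mulrA 2!(mulrCA _ (\prod_k M k k ^+ g k)) -mulrDr eq0 mulr0.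
have deg_le2 := stable_pair_deg_le2 stab' disj c1_neq0 c2_neq0.
have fE' : f = Zmon R (D g) * (c1 *: Zmon R (D a) + c2 *: (Zmon R (D b) *
    \prod_(k < n) \prod_(l < n | (k < l)%N) zvar R k l ^+ e k l)).
  by rewrite fE X1 X2 mulrDr !scalerAr.
have sign2 := stable_pair_deg2_sign stab' disj c2_neq0.
exists c1, c2, (D g); split.
  by split=> //; [exact: is_exponent_diag | exact: diag_mx_is_diag].
(* An off-diagonal variable in the second term leads to form b), its absence to form a). *)
have [/existsP[i /existsP[j /andP[ij eij]]]|e0] :=
    boolP [exists i : 'I_n, exists j : 'I_n, (i < j)%N && (0 < e i j)%N].
  right; exists i, j.
  have [dega degb prod_a prod_e] := stable_pair_offdiag (fun k => zvar R k k)
    (@zvar R n) stab' disj c1_neq0 c2_neq0 ij eij.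
  split=> //; first by rewrite fE' prod_e !Zmon_diag prod_a (prod_exp0 _ degb) mul1r.
  have := sign2; rewrite dega degb => /(_ erefl); rewrite sqrrN expr1n mulr1.
  by rewrite -realN; exact: ger0_real.
have {}e0 (k l : 'I_n) : (k < l)%N -> e k l = 0%N.
  move=> kl; apply/eqP; rewrite -leqn0 leqNgt; apply: contra e0 => ekl.
  by apply/existsP; exists k; apply/existsP; exists l; rewrite kl.
left; split.
  move=> m; rewrite suppE !inE => /orP[]/eqP-> i j; rewrite neq_ltn.
    by case/orP => ?; [|rewrite zidxC]; exact: diag1.
  by case/orP => ?; [|rewrite zidxC]; exact: e0.
have Q1 : \prod_(k < n) \prod_(l < n | (k < l)%N) zvar R k l ^+ e k l = 1.
  by rewrite big1// => k _; rewrite big1// => l kl; rewrite e0.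
rewrite Q1 mulr1 in fE' X2.
(* Otherwise both monomials of f would be the common factor Z^g. *)
have deg_gt0 : (0 < diag_deg a + diag_deg b)%N.
  rewrite lt0n; apply: contra m12; rewrite addn_eq0 => /andP[/eqP a0 /eqP b0].
  have X12 : 'X_[m1] = 'X_[m2] :> polyZ R n.
    by rewrite X1 X2 !Zmon_diag !(prod_exp0 _ a0) (prod_exp0 _ b0).
  by have := msuppX R[i] m1; rewrite X12 msuppX => -[->].
exists (D a), (D b); split; first by split=> //; exact: is_exponent_diag.
have norm_le : norm1 (D a - D b) <= 2.
  by apply: le_trans (norm1_diag_sub a b) _; rewrite (ler_nat _ _ 2).
have D_neq0 : D a != 0 \/ D b != 0.
  have [|k] := @sum_pos_exists _ (fun k => a k + b k)%N.
    by rewrite big_split.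
  have Dn0 (u : 'I_n -> nat) : (0 < u k)%N -> D u != 0.
    move=> uk; apply/negP => /eqP/matrixP/(_ k k)/eqP.
    by rewrite !mxE eqxx mulr1n pnatr_eq0 gtn_eqF.
  by rewrite addn_gt0 => /orP[/Dn0|/Dn0]; [left|right].
have ratio_neq0 : c1 / c2 != 0 by rewrite mulf_neq0 ?invr_eq0.
have neg_ratio : 0 <= - (c1 / c2) -> c1 / c2 < 0.
  by rewrite oppr_ge0 lt_neqAle ratio_neq0.
(* The five degree pairs with 1 <= A + B <= 2: the first two give (i), the third (ii), the last two
   (iii). *)
have degs : (diag_deg a = 1 /\ diag_deg b = 0 \/ diag_deg a = 0 /\ diag_deg b = 1 \/
  diag_deg a = 1 /\ diag_deg b = 1 \/ diag_deg a = 2 /\ diag_deg b = 0 \/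
  diag_deg a = 0 /\ diag_deg b = 2)%N by lia.
suff [ncf forms] : no_common_factor (Zmon R (D a)) (Zmon R (D b)) /\
    [\/ exists i : 'I_n, [:: Zmon R (D a); Zmon R (D b)] =i [:: 1; zvar R i i],
        exists i j : 'I_n,
          [:: Zmon R (D a); Zmon R (D b)] =i [:: zvar R i i; zvar R j j]
          /\ 0 <= c1 / c2
      | exists i j : 'I_n,
          [:: Zmon R (D a); Zmon R (D b)] =i [:: 1; zvar R i i * zvar R j j]
          /\ c1 / c2 < 0] by [].
rewrite !Zmon_diag.
case: degs => [[A1 B0]|[[A0 B1]|[[A1 B1]|[[A2 B0]|[A0 B2]]]]].
- have [i _ ->] := prod_exp1 (polyZ R n) A1; rewrite (prod_exp0 _ B0).
  split; first exact/no_common_factorC/no_common_factor1l.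
  by apply: Or31; exists i => q; rewrite !inE orbC.
- have [i _ ->] := prod_exp1 (polyZ R n) B1; rewrite (prod_exp0 _ A0).
  by split; [exact: no_common_factor1l | apply: Or31; exists i].
- have [i ai ->] := prod_exp1 (polyZ R n) A1.
  have [j bj ->] := prod_exp1 (polyZ R n) B1.
  have ij : i != j by apply: contraTneq ai => ->; case: (disj j) bj => ->.
  split; first exact: no_common_factor_zvar.
  apply: Or32; exists i, j; split=> //.
  (* Here A = 1, and the sign (-1)^A cancels the minus in front of c1/c2. *)
  by have := sign2; rewrite A1 B1 expr1 mulrN1 opprK; apply.
- have [i [j ->]] := prod_exp2 (polyZ R n) A2; rewrite (prod_exp0 _ B0).
  split; first exact/no_common_factorC/no_common_factor1l.
  apply: Or33; exists i, j; split; first by move=> q; rewrite !inE orbC.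
  by apply: neg_ratio; have := sign2; rewrite A2 B0 sqrrN expr1n mulr1; apply.
- have [i [j ->]] := prod_exp2 (polyZ R n) B2; rewrite (prod_exp0 _ A0).
  split; first exact: no_common_factor1l.
  apply: Or33; exists i, j; split=> //.
  by apply: neg_ratio; have := sign2; rewrite A0 B2 expr0 mulr1; apply.
Qed.
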